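(* Suppose $\sum_{n}\frac{|a_n|}{\lambda_n}<\infty$. If at least one grouped coefficient $B_j$ is nonzero, then the moments $S_k$, $k\ge1$, cannot all vanish. Consequently, $m_*:=\min\{k\in\mathbb{N}: k\ge 1,\ S_k\ne0\}$ is a finite positive integer for every nontrivial grouped spectral observation (that is, whenever some $B_j\neq 0$).
   Context: Let $H$ be a real separable Hilbert space and $\mathcal{A}:\operatorname{Dom}(\mathcal{A})\subset H\to H$ a self-adjoint, strictly positive operator with compact resolvent, with eigenvalues counted with multiplicity $0<\lambda_1\le\lambda_2\le\cdots$ and an orthonormal eigenbasis $\{v_n\}$, $\mathcal{A}v_n=\lambda_nv_n$; in infinite dimensions $\lambda_n\to\infty$, and in finite dimensions the list of eigenvalues is finite and all spectral sums terminate accordingly. Let $\{a_n\}\subset\mathbb{R}$ be real coefficients. The resolvent moments are $S_k=\sum_{n}\frac{a_n}{\lambda_n^k}$, $k\ge1$ (finite under the summability hypothesis). Let $\{\mu_j\}_{j\in J}$ be the distinct eigenvalues of $\mathcal{A}$; the grouped coefficients are the finite sums $B_j=\sum_{\{n:\lambda_n=\mu_j\}}a_n$. The associated scalar observation is $M_\alpha(t)=\sum_n a_nE_{\alpha,1}(-\lambda_nt^\alpha)=\sum_{j\in J}B_jE_{\alpha,1}(-\mu_jt^\alpha)$, with $E_{\alpha,1}(z)=\sum_{i\ge0}z^i/\Gamma(\alpha i+1)$ the Mittag-Leffler function. *)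

(* Defs.v *)
From HB Require Import structures.
From mathcomp Require Import all_boot all_order all_algebra.
From mathcomp Require Import all_classical all_reals all_analysis.

Set Implicit Arguments.
Unset Strict Implicit.
Unset Printing Implicit Defensive.

Import Order.TTheory GRing.Theory Num.Theory.
Import numFieldNormedType.Exports.

Local Open Scope classical_set_scope.
Local Open Scope ring_scope.

(* MathComp-Analysis has no Hilbert spaces: a real Hilbert space is a complete
   normed module over a realType with an inner product inducing its norm. *)
Definition induces_norm (R : realType) (H : completeNormedModType R)
    (ip : {dot H for idfun}) : Prop :=
  forall x : H, ip x x = `|x| ^+ 2.

Definition separable_space (T : topologicalType) : Prop :=
  exists2 D : set T, countable D & dense D.

(* A linear operator Dom(A) -> H; the values of [op_fun] outside [op_dom] are
   junk, and no definition below looks at them. *)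
Record operator (R : realType) (H : completeNormedModType R) := Operator {
  op_dom : set H;
  op_fun :> H -> H;
  op_dom0 : op_dom 0;
  op_dom_lin : forall (c : R) (x y : H),
    op_dom x -> op_dom y -> op_dom (c *: x + y);
  op_lin : forall (c : R) (x y : H),
    op_dom x -> op_dom y -> op_fun (c *: x + y) = c *: op_fun x + op_fun y
}.

Section Operators.
Variables (R : realType) (H : completeNormedModType R).
Variables (ip : {dot H for idfun}) (A : operator H).

Definition op_graph : set (H * H) :=
  [set p | op_dom A p.1 /\ A p.1 = p.2].

Definition adjoint_graph : set (H * H) :=
  [set p | forall x : H, op_dom A x -> ip (A x) p.1 = ip x p.2].

Definition self_adjoint : Prop :=
  dense (op_dom A) /\ op_graph = adjoint_graph.

Definition strictly_positive : Prop :=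
  forall x : H, op_dom A x -> x != 0 -> 0 < ip (A x) x.

(* [T] is the everywhere defined, two-sided inverse of A - z. *)
Definition is_resolvent (z : R) (T : H -> H) : Prop :=
  (forall y : H, op_dom A (T y) /\ A (T y) - z *: T y = y) /\
  (forall x : H, op_dom A x -> T (A x - z *: x) = x).

(* Compact maps are bounded, so z is then in the resolvent set of A; for one z
   or for all z in the resolvent set is the same by the resolvent identity. *)
Definition compact_resolvent : Prop :=
  exists (z : R) (T : H -> H), is_resolvent z T /\
    forall X : set H, bounded_set X -> precompact (T @` X).

Definition is_eigenvalue (mu : R) : Prop :=
  exists x : H, [/\ op_dom A x, x != 0 & A x = mu *: x].

(* The index set of the eigenvalues, numbered from 0: all of nat for [None]
   (infinite dimension), {0, ..., d - 1} for [Some d] (dimension d). *)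
Definition eig_index (N : option nat) (n : nat) : bool :=
  if N is Some d then (n < d)%N else true.

(* Divergence of an infinite list of eigenvalues is not assumed: it follows
   from the compactness of the resolvent. *)
Record eigenbasis (N : option nat) (lambda : nat -> R) (v : nat -> H) : Prop :=
  Eigenbasis {
    eig_gt0 : forall n, eig_index N n -> 0 < lambda n;
    eig_nondecreasing : forall m n, eig_index N m -> eig_index N n -> (m <= n)%N ->
      lambda m <= lambda n;
    eig_dom : forall n, eig_index N n -> op_dom A (v n);
    eig_eq : forall n, eig_index N n -> A (v n) = lambda n *: v n;
    eig_orthonormal : forall m n, eig_index N m -> eig_index N n ->
      ip (v m) (v n) = (m == n)%:R;
    eig_basis : forall x : H,
      \sum_(0 <= n < m | eig_index N n) ip x (v n) *: v n @[m --> \oo] --> x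
  }.

End Operators.

Section Moments.
Variables (R : realType) (N : option nat) (lambda a : nat -> R).

(* The sum is taken in the extended reals, so finiteness is not vacuous. *)
Definition moment_summable : Prop :=
  (\sum_(0 <= n <oo | eig_index N n) (`|a n| / lambda n)%:E < +oo)%E.

(* The limit of the partial sums; these converge (absolutely) for k >= 1 when
   [moment_summable] holds, the eigenvalues being bounded away from 0. *)
Definition moment (k : nat) : R :=
  limn (fun m : nat =>
    \sum_(0 <= n < m | eig_index N n) a n / lambda n ^+ k).

(* A sum over a finite set, every eigenvalue having finite multiplicity. The
   distinct eigenvalues mu_j serve as their own indices: B_j is
   [grouped_coef mu_j]. *)
Definition grouped_coef (mu : R) : R :=
  \sum_(n \in [set n | eig_index N n /\ lambda n = mu]) a n.

End Moments.

Definition is_min (E : set nat) (m : nat) : Prop :=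
  E m /\ forall k : nat, E k -> (m <= k)%N.

(* Main.v *)
Require Import Defs.
From HB Require Import structures.
From mathcomp Require Import all_boot all_order all_algebra.
From mathcomp Require Import finmap.
From mathcomp Require Import all_classical all_reals all_analysis.

Import Order.TTheory GRing.Theory Num.Theory.
Import numFieldNormedType.Exports.

Local Open Scope classical_set_scope.
Local Open Scope ring_scope.

(** The k-th moment is a sum of exponentials in k, one for each distinct
    eigenvalue mu, with weight B_mu:
      S_k = sum over mu of B_mu * mu^(-k).
    As k grows, the smallest mu with B_mu != 0 dominates all the others, so that
    mu^k * S_k tends to B_mu, which rules out S_k = 0 for every k >= 1.

    A smallest such mu exists because the eigenvalues are listed in nondecreasing
    order: it is the eigenvalue of least index whose grouped coefficient is
    nonzero.  The partial sums of S_k then split into three parts.  The indices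
    with eigenvalue below mu form finitely many finite groups and contribute 0
    ([sum_below_eq0]).  Those with eigenvalue mu contribute B_mu / mu^k
    ([grouped_coef_partial_sum]).  The remaining eigenvalues stay above some
    nu > mu ([eigenvalue_gap]), and since sum |a_n| / lambda_n is a finite number
    C they contribute at most C / nu^(k-1) ([moment_term_le]).  Hence
      |S_k - B_mu / mu^k| <= C / nu^(k-1)
    ([first_group_dominates]), and the geometric ratio mu / nu < 1 concludes. *)

Lemma sum_by_value (M : nmodType) (I : Type) (T : eqType) (r : seq I)
    (P : pred I) (g : I -> T) (F : I -> M) :
  \sum_(i <- r | P i) F i =
  \sum_(x <- undup ([seq g i | i <- r & P i])) \sum_(i <- r | P i && (g i == x)) F i.
Proof.
rewrite -big_filter.
under [RHS]eq_bigr do rewrite -big_filter_cond.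
move: [seq i <- r | P i] => {r P} s.
under [RHS]eq_bigr do rewrite big_mkcond.
rewrite exchange_big /=.
have: {subset map g s <= undup (map g s)} by move=> x; rewrite mem_undup.
have := undup_uniq (map g s); move: (undup _) => u u_uniq.
elim: s => [|i s IHs] /= sub; first by rewrite !big_nil.
rewrite !big_cons IHs; last by move=> x xs; apply: sub; rewrite inE xs orbT.
congr (_ + _); rewrite (bigD1_seq (g i)) //=; last by apply: sub; rewrite mem_head.
rewrite eqxx big1 ?addr0 // => x; rewrite eq_sym; by move/negbTE ->.
Qed.

Section ResolventMoments.
Variables (R : realType) (N : option nat) (lambda a : nat -> R).
Hypothesis lambda_gt0 : forall n, eig_index N n -> 0 < lambda n.
Hypothesis lambda_le : forall m n, eig_index N m -> eig_index N n ->
  (m <= n)%N -> lambda m <= lambda n.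

(** A nondecreasing list cannot accumulate at mu from above: the first entry
    above mu is the least one.  With mu = 0 this bounds the spectrum away
    from 0. *)
Lemma eigenvalue_gap (mu : R) :
  exists2 nu, mu < nu & forall i, eig_index N i -> mu < lambda i -> nu <= lambda i.
Proof.
have [ex|nex] := pselect (exists i, eig_index N i && (mu < lambda i)); last first.
  (* No eigenvalue exceeds mu, so any number above mu will do. *)
  exists (mu + 1); first by rewrite ltrDl.
  by move=> i Ni mu_lt; case: nex; exists i; rewrite Ni.
case: (ex_minnP ex) => n /andP[Nn mu_lt] n_min; exists (lambda n) => // i Ni lt_i.
by apply: lambda_le => //; apply: n_min; rewrite Ni.
Qed.

Lemma grouped_coef_partial_sum (mu : R) (m : nat) :
  (forall i, eig_index N i -> lambda i = mu -> a i != 0 -> (i < m)%N) ->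
  grouped_coef N lambda a mu =
  \sum_(0 <= i < m | eig_index N i && (lambda i == mu)) a i.
Proof.
move=> supp; rewrite /grouped_coef.
rewrite (fsbigE [seq i <- index_iota 0 m | eig_index N i && (lambda i == mu)]).
- rewrite big_filter_cond; apply: eq_bigl => i.
  case: (boolP (eig_index N i && _)) => //= /andP[Ni /eqP lam]; exact: mem_set.
- by rewrite filter_uniq // iota_uniq.
- by move=> i /=; rewrite mem_filter => /andP[/andP[Ni /eqP lam] _].
- move=> i /= [Ni lam]; rewrite mem_filter Ni lam eqxx /= mem_index_iota /=.
  by apply: contraNeq; exact: supp.
Qed.

(** A [\sum_(i \in _)] over an infinite support is 0 by convention, so a nonzero
    grouped coefficient certifies that its group has finite support. *)
Lemma grouped_coef_neq0 (mu : R) :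
  grouped_coef N lambda a mu != 0 ->
  (exists2 n, eig_index N n & lambda n = mu) /\
  exists m, forall i, eig_index N i -> lambda i = mu -> a i != 0 -> (i < m)%N.
Proof.
move=> B0; split.
  apply: contrapT => no_index; case/negP: B0; rewrite /grouped_coef fsbig1 // => n [Nn lam].
  by case: no_index; exists n.
move: B0; rewrite /grouped_coef; case: finite_supportP => [_|X _ _ X_supp _].
  by rewrite big_nil eqxx.
exists (\max_(i <- X) i).+1 => i Ni lam ai; rewrite ltnS.
apply: leq_bigmax_seq => //.
have: [set` X] i by rewrite X_supp; split => //=; apply/eqP.
by [].
Qed.

Hypothesis summable : moment_summable N lambda a.

Lemma weighted_abs_sum_bounded :
  exists C, forall m, \sum_(0 <= i < m | eig_index N i) `|a i| / lambda i <= C.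
Proof.
have ge0 i : eig_index N i -> (0 <= (`|a i| / lambda i)%:E)%E.
  by move=> Ni; rewrite lee_fin divr_ge0 // ltW // lambda_gt0.
exists (fine (\sum_(0 <= n <oo | eig_index N n) (`|a n| / lambda n)%:E)%E) => m.
rewrite -lee_fin fineK; last first.
  rewrite ge0_fin_numE; first exact: summable.
  by apply: nneseries_ge0 => n _; exact: ge0.
rewrite -sumEFin; apply: nneseries_lim_ge => n _; exact: ge0.
Qed.

(** One factor 1 / lambda_i is kept for the summability of |a_i| / lambda_i; the
    other k factors are at most 1 / nu, whence the exponent [k.+1] here and in the
    moments below. *)
Lemma moment_term_le (nu : R) (i k : nat) : eig_index N i -> 0 < nu ->
  nu <= lambda i -> `|a i / lambda i ^+ k.+1| <= `|a i| / lambda i / nu ^+ k.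
Proof.
move=> Ni nu0 nu_le; have l0 := lambda_gt0 _ Ni.
rewrite normrM normfV normrX (gtr0_norm l0) exprS invfM mulrA.
apply: ler_wpM2l; first by rewrite divr_ge0 // ltW.
by rewrite lef_pV2 ?posrE ?exprn_gt0 // lerXn2r // nnegrE ltW.
Qed.

Lemma moment_cvg (k : nat) :
  cvgn (fun m : nat =>
    \sum_(0 <= i < m | eig_index N i) a i / lambda i ^+ k.+1).
Proof.
have [C HC] := weighted_abs_sum_bounded.
have [nu nu0 nu_le] := eigenvalue_gap 0.
under eq_fun do rewrite big_mkcond /=.
apply: normed_cvg.
suff: cvgn (fun m => \sum_(0 <= i < m)
    `|if eig_index N i then a i / lambda i ^+ k.+1 else 0|) by [].
apply: nondecreasing_is_cvgn.
  apply/nondecreasing_seqP => m; rewrite big_nat_recr //=.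
  by rewrite lerDl.
exists (C / nu ^+ k) => _ [m _ <-].
apply: (@le_trans _ _ ((\sum_(0 <= i < m | eig_index N i) `|a i| / lambda i) / nu ^+ k)); last first.
  by rewrite ler_pM2r // invr_gt0 exprn_gt0.
rewrite mulr_suml [leRHS]big_mkcond; apply: ler_sum => i _.
case: ifP => Ni; last by rewrite normr0.
by apply: moment_term_le => //; apply: nu_le => //; exact: lambda_gt0.
Qed.

(** Monotonicity places every index of a group below [lambda n] before [n], so a
    partial sum up to [m >= n] contains these groups entirely, and can be
    regrouped by eigenvalue. *)
Lemma sum_below_eq0 (n m k : nat) : eig_index N n -> (n <= m)%N ->
  (forall i, eig_index N i -> lambda i < lambda n ->
     grouped_coef N lambda a (lambda i) = 0) ->
  \sum_(0 <= i < m | eig_index N i && (lambda i < lambda n)) a i / lambda i ^+ k = 0.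
Proof.
move=> Nn le_nm zero.
rewrite (sum_by_value _ _ _ _ _ lambda) big_seq big1 // => x.
rewrite mem_undup => /mapP[j]; rewrite mem_filter => /andP[/andP[Nj lt_j] _] ->.
rewrite (eq_bigl (fun i => eig_index N i && (lambda i == lambda j))); last first.
  by move=> i; case: eqP => [->|_]; rewrite ?lt_j ?andbT ?andbF.
rewrite (eq_bigr (fun i => a i / lambda j ^+ k)); last by move=> i /andP[_ /eqP ->].
rewrite -mulr_suml -grouped_coef_partial_sum ?zero ?mul0r // => i Ni lam _.
apply: leq_trans le_nm; rewrite ltnNge; apply/negP => /(lambda_le _ _ Nn Ni).
by rewrite lam leNgt lt_j.
Qed.

(** Comparing partial sums rather than limits avoids splitting the series: from
    some [m] on, the difference between the partial sum and the term of the first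
    group is exactly the partial sum over the eigenvalues above [lambda n]. *)
Lemma first_group_dominates (n : nat) : eig_index N n ->
  (forall i, eig_index N i -> lambda i < lambda n ->
     grouped_coef N lambda a (lambda i) = 0) ->
  grouped_coef N lambda a (lambda n) != 0 ->
  exists C nu, lambda n < nu /\ forall k,
  `|moment N lambda a k.+1 - grouped_coef N lambda a (lambda n) / lambda n ^+ k.+1|
  <= C / nu ^+ k.
Proof.
move=> Nn zero B0; have [_ [p supp]] := grouped_coef_neq0 _ B0.
have [C HC] := weighted_abs_sum_bounded.
have [nu lt_nu nu_le] := eigenvalue_gap (lambda n).
have nu0 : 0 < nu by apply: lt_trans lt_nu; exact: lambda_gt0.
exists C, nu; split => // k.
pose u m := \sum_(0 <= i < m | eig_index N i) a i / lambda i ^+ k.+1.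
set c := _ / _ ^+ k.+1.
have cu : (`|u m - c|) @[m --> \oo] --> `|moment N lambda a k.+1 - c|.
  by apply: cvg_norm; apply: cvgB; [exact: moment_cvg | exact: cvg_cst].
rewrite -(cvg_lim _ cu) //; apply: limr_le; first by apply/cvg_ex; eexists; exact: cu.
exists (maxn n p) => // m /=; rewrite geq_max => /andP[le_nm le_pm].
have -> : u m - c =
    \sum_(0 <= i < m | eig_index N i && (lambda n < lambda i)) a i / lambda i ^+ k.+1.
  rewrite /u (bigID (fun i => lambda i < lambda n)) /= sum_below_eq0 // add0r.
  rewrite (bigID (fun i => lambda i == lambda n)) /=.
  rewrite (eq_bigl (fun i => eig_index N i && (lambda i == lambda n))); last first.
    by move=> i; case: eqP => [->|_]; rewrite ?ltxx ?andbT ?andbF.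
  rewrite (eq_bigr (fun i => a i / lambda n ^+ k.+1)); last by move=> i /andP[_ /eqP ->].
  rewrite -mulr_suml -grouped_coef_partial_sum; last first.
    by move=> i Ni lam ai; apply: leq_trans le_pm; exact: supp.
  rewrite addrAC subrr add0r; apply: eq_bigl => i.
  by rewrite -andbA; case: ltgtP.
apply: (le_trans (ler_norm_sum _ _ _)).
apply: (@le_trans _ _ ((\sum_(0 <= i < m | eig_index N i) `|a i| / lambda i) / nu ^+ k)); last first.
  by rewrite ler_pM2r // invr_gt0 exprn_gt0.
rewrite mulr_suml big_mkcond [leRHS]big_mkcond; apply: ler_sum => i _ /=.
case: (boolP (eig_index N i)) => Ni //=; case: ifP => [lt_i|_].
  by apply: moment_term_le => //; exact: nu_le.
by rewrite !mulr_ge0 ?invr_ge0 ?exprn_ge0 // ltW // lambda_gt0.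
Qed.

Lemma exists_moment_neq0 (mu : R) : grouped_coef N lambda a mu != 0 ->
  exists k, moment N lambda a k.+1 != 0.
Proof.
move=> Bmu; have [[j Nj lam_j] _] := grouped_coef_neq0 _ Bmu.
have ex : exists i, eig_index N i && (grouped_coef N lambda a (lambda i) != 0).
  by exists j; rewrite Nj lam_j.
case: (ex_minnP ex) => n /andP[Nn B0] n_min.
have zero i : eig_index N i -> lambda i < lambda n ->
    grouped_coef N lambda a (lambda i) = 0.
  move=> Ni lt_i; apply/eqP; apply: contraLR lt_i => Bi.
  by rewrite -leNgt; apply: lambda_le => //; apply: n_min; rewrite Ni.
have [C [nu [lt_nu bound]]] := first_group_dominates _ Nn zero B0.
have l0 := lambda_gt0 _ Nn; have nu0 := lt_trans l0 lt_nu.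
apply: contrapT => /forallNP all0.
have q_lt1 : `|lambda n / nu| < 1.
  by rewrite gtr0_norm ?divr_gt0 // ltr_pdivrMr // mul1r.
(* If all moments vanish, then multiplying the bound by lambda_n^(k+1) gives
   |B| <= C * lambda_n * (lambda_n / nu)^k for every k. *)
have lim0 : (C * lambda n * (lambda n / nu) ^+ k) @[k --> \oo] --> (0 : R).
  rewrite -[X in _ --> X](mulr0 (C * lambda n)).
  by apply: cvgM; [exact: cvg_cst | exact: cvg_expr].
have : `|grouped_coef N lambda a (lambda n)| <= 0.
  rewrite -(cvg_lim _ lim0) //; apply: limr_ge; first by apply/cvg_ex; eexists; exact: lim0.
  exists 0%N => // k _ /=.
  have := bound k; have /negP := all0 k; rewrite negbK => /eqP ->.
  rewrite sub0r normrN normrM normfV normrX (gtr0_norm l0).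
  rewrite ler_pdivrMr ?exprn_gt0 // => /le_trans; apply.
  by rewrite expr_div_n exprS mulrACA (mulrC (nu ^- k)).
by rewrite normr_le0 (negbTE B0).
Qed.

End ResolventMoments.

Theorem lemma2p4 (R : realType) (H : completeNormedModType R)
    (ip : {dot H for idfun}) (hnorm : induces_norm ip)
    (hsep : separable_space H)
    (A : operator H) (hsa : self_adjoint ip A) (hpos : strictly_positive ip A)
    (hres : compact_resolvent A)
    (N : option nat) (lambda : nat -> R) (v : nat -> H)
    (heig : eigenbasis ip A N lambda v)
    (a : nat -> R) (hsum : moment_summable N lambda a)
    (hB : exists2 mu : R, is_eigenvalue A mu & grouped_coef N lambda a mu != 0) :
  ~ (forall k : nat, (1 <= k)%N -> moment N lambda a k = 0) /\
  exists m : nat, (0 < m)%N /\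
    is_min [set k : nat | (1 <= k)%N /\ moment N lambda a k != 0] m.
Proof.
have [mu _ Bmu] := hB.
have [k Sk] := exists_moment_neq0 _ _ _ _ (eig_gt0 heig) (eig_nondecreasing heig)
  hsum _ Bmu.
split; first by move=> /(_ k.+1 isT) Sk0; rewrite Sk0 eqxx in Sk.
have ex : exists j, (0 < j)%N && (moment N lambda a j != 0) by exists k.+1.
case: (ex_minnP ex) => m /andP[m0 Sm] m_min; exists m; split=> //; split=> //.
by move=> j [j0 Sj]; apply: m_min; rewrite j0.
Qed.
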